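(* Let $N\ge 3$ and let $\mathbf U=(\mathbf u_1,\dots,\mathbf u_N)$ be a configuration of $N$ distinct labeled points on the unit sphere $\mathbb S^2\subset\mathbb R^3$. If $\mathbf U$ is balanced, then $\mathbf U$ is critical for maximizing the injectivity radius $\rho$.
   Context: $\mathrm{Conf}(N)\subset(\mathbb S^2)^N$ is the space of $N$-tuples of distinct labeled points of the unit sphere $\mathbb S^2\subset\mathbb R^3$. For $\mathbf u,\mathbf v\in\mathbb S^2$, $\theta(\mathbf u,\mathbf v)\in[0,\pi]$ is the angular distance. The injectivity radius function is $\rho(\mathbf U)=\frac12\min_{i\ne j}\theta(\mathbf u_i,\mathbf u_j)$. Contact graph of $\mathbf U$: with $\theta=2\rho(\mathbf U)$, the graph embedded in $\mathbb S^2$ whose vertices are the points $\mathbf u_i$ and whose edges are the (minimizing) geodesic segments $[\mathbf u_i,\mathbf u_j]$ for all pairs with $\theta(\mathbf u_i,\mathbf u_j)=\theta$. A stress graph for $\mathbf U$ is the contact graph together with weights $w_e\ge 0$ on its edges. An edge $e=[\mathbf u_i,\mathbf u_j]$ exerts at each of its endpoints $\mathbf u$ a tangential force $w_e\,T_e|_{\mathbf u}$, where $T_e|_{\mathbf u}\in T_{\mathbf u}\mathbb S^2$ is the outward unit tangent vector to $e$ at the endpoint $\mathbf u$. The stress graph is balanced if at every point $\mathbf u_i$ the vector sum of these forces in $T_{\mathbf u_i}\mathbb S^2$ is zero. The configuration $\mathbf U$ is balanced if its contact graph has a balanced stress graph for some choice of nonnegative, not everywhere zero weights. Criticality: for a tangent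 vector $\mathbf V=(\mathbf v_1,\dots,\mathbf v_N)$ to $\mathrm{Conf}(N)$ at $\mathbf U$ (so $\mathbf v_i\in T_{\mathbf u_i}\mathbb S^2$) and small $t$, put $\mathbf U\#t\mathbf V=\left(\frac{\mathbf u_1+t\mathbf v_1}{|\mathbf u_1+t\mathbf v_1|},\dots,\frac{\mathbf u_N+t\mathbf v_N}{|\mathbf u_N+t\mathbf v_N|}\right)$. The configuration $\mathbf U$ is critical for maximizing $\rho$ if for every such $\mathbf V$ one has $[\rho(\mathbf U\#t\mathbf V)-\rho(\mathbf U)]_+=o(t)$ as $t\to0$, where $[g]_+=\max\{g,0\}$; equivalently, no variation $\mathbf V$ increases $\rho$ to first order. *)

(* Defs.v *)
From HB Require Import structures.
From mathcomp Require Import all_boot all_order all_algebra.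
From mathcomp Require Import all_classical all_reals all_analysis.

Set Implicit Arguments.
Unset Strict Implicit.
Unset Printing Implicit Defensive.

Import Order.TTheory GRing.Theory Num.Theory.
Import numFieldNormedType.Exports.

Local Open Scope classical_set_scope.
Local Open Scope ring_scope.

(* The norm that the library puts on 'rV[R]_3 is the sup norm, hence the
   separate Euclidean structure. *)
Definition dotp (R : realType) (u v : 'rV[R]_3) : R := (u *m v^T) 0 0.

Definition enorm (R : realType) (u : 'rV[R]_3) : R := Num.sqrt (dotp u u).

Definition normalize (R : realType) (u : 'rV[R]_3) : 'rV[R]_3 :=
  (enorm u)^-1 *: u.

Definition sphere2 (R : realType) : set 'rV[R]_3 := [set u | enorm u = 1].

Definition tangent_space (R : realType) (u : 'rV[R]_3) : set 'rV[R]_3 :=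
  [set v | dotp u v = 0].

Definition Conf (R : realType) (N : nat) : set ('I_N -> 'rV[R]_3) :=
  [set U | (forall i, sphere2 (U i)) /\ injective U].

Definition angle (R : realType) (u v : 'rV[R]_3) : R := acos (dotp u v).

(* Angles never exceed pi, so for N >= 2 the default value pi of the iterated
   minimum does not contribute. *)
Definition inj_radius (R : realType) (N : nat) (U : 'I_N -> 'rV[R]_3) : R :=
  2^-1 * \big[Num.min/pi]_(p : 'I_N * 'I_N | p.1 != p.2)
           angle (U p.1) (U p.2).

Definition contact (R : realType) (N : nat) (U : 'I_N -> 'rV[R]_3) : rel 'I_N :=
  [rel i j | (i != j) && (angle (U i) (U j) == 2 * inj_radius U)].

(* Outward unit tangent vector at u to the minimizing geodesic segment [u, v].
   The segment leaves u in the direction of v - <u, v> u, the orthogonal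
   projection of v on the tangent plane at u; the outward direction is the
   opposite one.  The value is meaningless (zero) for v = u and v = - u; in
   a configuration of at least three points no contact edge joins antipodes. *)
Definition outward_tangent (R : realType) (u v : 'rV[R]_3) : 'rV[R]_3 :=
  normalize (dotp u v *: u - v).

(* A weight on the unoriented contact edges is a function of ordered pairs of
   labels which is symmetric on edges; its values off the edges are ignored. *)
Definition stress (R : realType) (N : nat) (U : 'I_N -> 'rV[R]_3)
    (w : 'I_N -> 'I_N -> R) : Prop :=
  forall i j, contact U i j -> w i j = w j i /\ 0 <= w i j.

Definition balanced_stress (R : realType) (N : nat) (U : 'I_N -> 'rV[R]_3)
    (w : 'I_N -> 'I_N -> R) : Prop :=
  stress U w /\
  forall i, \sum_(j | contact U i j) w i j *: outward_tangent (U i) (U j) = 0.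

Definition balanced (R : realType) (N : nat) (U : 'I_N -> 'rV[R]_3) : Prop :=
  exists w : 'I_N -> 'I_N -> R,
    balanced_stress U w /\ exists i j, contact U i j /\ w i j != 0.

Definition tangent_vector (R : realType) (N : nat) (U V : 'I_N -> 'rV[R]_3) :
    Prop :=
  forall i, tangent_space (U i) (V i).

(* The deformed configuration U # tV *)
Definition deform (R : realType) (N : nat) (U V : 'I_N -> 'rV[R]_3) (t : R) :
    'I_N -> 'rV[R]_3 :=
  fun i => normalize (U i + t *: V i).

Definition critical (R : realType) (N : nat) (U : 'I_N -> 'rV[R]_3) : Prop :=
  forall V : 'I_N -> 'rV[R]_3, tangent_vector U V ->
    (fun t : R => Num.max (inj_radius (deform U V t) - inj_radius U) 0)
      =o_ (0 : R) (fun t : R => t).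

(* Main.v *)
Require Import Defs.
From mathcomp Require Import all_boot all_order all_algebra.
From mathcomp Require Import all_classical all_reals all_analysis.
From mathcomp Require Import ring lra.

(** Every pair of labels bounds the minimum: 2 rho(U#tV) <= theta_ij(t), with
equality at t = 0 when ij is a contact edge.  Averaging these bounds with the
stress weights gives

  W * 2 (rho(U#tV) - rho(U)) <= sum of w_ij (theta_ij(t) - theta_ij(0)),

where W > 0 is the total weight, so it suffices that the right-hand side has
zero derivative at t = 0 ([weighted_min_littleo]).

The first variation of an edge length is
theta_ij'(0) = - (<u_i, v_j> + <v_i, u_j>) / sqrt (1 - <u_i, u_j>^2)
([is_derive_angle]): deforming along tangent vectors keeps the points at norm
1 up to second order, so the renormalization does not contribute.  All contact
edges share the same length, hence the same square root, which is nonzero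
because a contact edge joins neither equal nor antipodal points
([Conf_dotp_lt1], [contact_dotp_gtN1]).  The same square root normalizes the
outward tangent vectors, and pairing the balance equation at u_i with v_i
therefore reads sum_j w_ij <v_i, u_j> = 0 ([balanced_stress_tangent]).
Summing over i, and using the symmetry of the weights for the terms
<u_i, v_j>, the weighted sum of first variations vanishes. *)

Set Implicit Arguments.
Unset Strict Implicit.

Import Order.TTheory GRing.Theory Num.Theory.
Import numFieldNormedType.Exports.

Local Open Scope classical_set_scope.
Local Open Scope ring_scope.

(** * First-order bounds for a minimum of functions *)

Lemma is_derive_bigsum (R : realType) (I : finType) (P : pred I)
    (f : I -> R -> R) (df : I -> R) (x : R) :
  (forall i, P i -> is_derive x 1 (f i) (df i)) ->
  is_derive x 1 (\sum_(i | P i) f i) (\sum_(i | P i) df i).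
Proof.
move=> fP; elim/big_ind2 : _ => //.
- exact: is_derive_cst.
- by move=> *; exact: is_deriveD.
Qed.

Lemma is_derive0_littleo (R : realType) (f : R -> R) :
  is_derive (0 : R) 1 f 0 ->
  forall e, 0 < e -> \forall t \near (0 : R), `|f t - f 0| <= e * `|t|.
Proof.
move=> [fd f0] e e0.
have : (fun h : R => h^-1 *: (f (h *: (1 : R) + 0) - f 0)) @ (0 : R)^' --> (0 : R).
  by rewrite -[X in _ --> X]f0; exact: fd.
move=> /cvgr0Pnorm_le/(_ _ e0); rewrite near_withinE => ft.
apply: filterS ft => t /= ft.
have [->|t0] := eqVneq t 0; first by rewrite subrr !normr0 mulr0.
move: (ft t0); rewrite addr0 /GRing.scale/= mulr1 normrM normfV.
by rewrite ler_pdivrMl ?normr_gt0// mulrC.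
Qed.

(** The combination of the f i with weights w dominates W * m, where W is the
total weight, and equals W * m0 at 0; being stationary there, it exceeds W * m0
by o(t) only, and W > 0 lets the bound pass to m.  The weights are the Lagrange
multipliers of the problem of maximizing the minimum of the f i. *)
Lemma weighted_min_littleo (R : realType) (I : finType) (P : pred I)
    (w : I -> R) (f : I -> R -> R) (df : I -> R) (m : R -> R) (m0 : R) :
  (forall i, P i -> 0 <= w i) -> 0 < \sum_(i | P i) w i ->
  (forall i, P i -> f i 0 = m0) ->
  (forall i t, P i -> m t <= f i t) ->
  (forall i, P i -> is_derive (0 : R) 1 (f i) (df i)) ->
  \sum_(i | P i) w i * df i = 0 ->
  (fun t : R => Num.max (m t - m0) 0) =o_ (0 : R) (fun t : R => t).
Proof.
move=> w0 W0 f0 mf fd bal; set W := \sum_(i | P i) w i in W0.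
pose G : R -> R := \sum_(i | P i) w i \*: f i.
have Gd : is_derive (0 : R) 1 G 0.
  rewrite -[X in is_derive _ _ _ X]bal.
  by apply: is_derive_bigsum => i /fd fdi; exact: is_deriveZ.
have GE t : G t = \sum_(i | P i) w i * f i t by rewrite /G fct_sumE.
have WG t : W * (m t - m0) <= G t - G 0.
  rewrite !GE -sumrB mulr_suml ler_sum// => i Pi.
  by rewrite -mulrBr ler_wpM2l ?w0// f0// lerD2r mf.
apply/eqoP => e e0; near=> t.
have : `|G t - G 0| <= W * e * `|t|.
  by near: t; apply: is_derive0_littleo => //; rewrite mulr_gt0.
rewrite -mulrA => Gt.
rewrite ger0_norm ?le_max ?lexx ?orbT// ge_max mulr_ge0 ?(ltW e0)// andbT.
rewrite -(ler_pM2l W0); apply: le_trans Gt.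
exact: le_trans (WG t) (ler_norm _).
Unshelve. all: by end_near.
Qed.

(** * Euclidean geometry of the sphere *)

Section dotp.
Variable R : realType.
Implicit Types u v : 'rV[R]_3.

Lemma dotpE u v : dotp u v = \sum_i u 0 i * v 0 i.
Proof. by rewrite /dotp mxE; apply: eq_bigr => i _; rewrite mxE. Qed.

Lemma dotpC u v : dotp u v = dotp v u.
Proof. by rewrite !dotpE; apply: eq_bigr => i _; rewrite mulrC. Qed.

Lemma dotpDl u u' v : dotp (u + u') v = dotp u v + dotp u' v.
Proof. by rewrite /dotp mulmxDl mxE. Qed.

Lemma dotpZl a u v : dotp (a *: u) v = a * dotp u v.
Proof. by rewrite /dotp -scalemxAl mxE. Qed.

Lemma dotpDr u v v' : dotp u (v + v') = dotp u v + dotp u v'.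
Proof. by rewrite dotpC dotpDl !(dotpC u). Qed.

Lemma dotpZr a u v : dotp u (a *: v) = a * dotp u v.
Proof. by rewrite dotpC dotpZl dotpC. Qed.

Lemma dotpNl u v : dotp (- u) v = - dotp u v.
Proof. by rewrite -scaleN1r dotpZl mulN1r. Qed.

Lemma dotpNr u v : dotp u (- v) = - dotp u v.
Proof. by rewrite dotpC dotpNl dotpC. Qed.

Lemma dotp0l v : dotp 0 v = 0.
Proof. by rewrite /dotp mul0mx mxE. Qed.

Lemma dotp_suml (I : finType) (P : pred I) (F : I -> 'rV[R]_3) v :
  dotp (\sum_(i | P i) F i) v = \sum_(i | P i) dotp (F i) v.
Proof. by rewrite /dotp mulmx_suml summxE. Qed.

Lemma dotp_ge0 u : 0 <= dotp u u.
Proof. by rewrite dotpE sumr_ge0// => i _; rewrite -expr2 sqr_ge0. Qed.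

Lemma dotp_eq0 u : dotp u u = 0 -> u = 0.
Proof.
rewrite dotpE => /psumr_eq0P u0; apply/rowP => i; rewrite mxE.
by apply/eqP; rewrite -sqrf_eq0 expr2 u0// => j _; rewrite -expr2 sqr_ge0.
Qed.

Lemma sphere2_dotp u : sphere2 u -> dotp u u = 1.
Proof.
by rewrite /sphere2 /= /enorm => u1; rewrite -(sqr_sqrtr (dotp_ge0 u)) u1 expr1n.
Qed.

Lemma dotp_sphere2_itv u v : sphere2 u -> sphere2 v -> -1 <= dotp u v <= 1.
Proof.
move=> /sphere2_dotp u1 /sphere2_dotp v1.
have := dotp_ge0 (u + v); have := dotp_ge0 (u - v).
rewrite !(dotpDl, dotpDr, dotpNl, dotpNr) (dotpC v u) u1 v1; lra.
Qed.

Lemma dotp_sphere2_eq1 u v : sphere2 u -> sphere2 v -> dotp u v = 1 -> u = v.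
Proof.
move=> /sphere2_dotp u1 /sphere2_dotp v1 uv.
apply/eqP; rewrite -subr_eq0; apply/eqP/dotp_eq0.
by rewrite !(dotpDl, dotpDr, dotpNl, dotpNr) (dotpC v u) u1 v1 uv; lra.
Qed.

Lemma dotp_sphere2_eqN1 u v :
  sphere2 u -> sphere2 v -> dotp u v = -1 -> u = - v.
Proof.
move=> u1 v1 uv; apply: dotp_sphere2_eq1 => //; last by rewrite dotpNr uv opprK.
by move: v1; rewrite /sphere2/= /enorm dotpNl dotpNr opprK.
Qed.

Lemma cos_angle u v : sphere2 u -> sphere2 v -> cos (angle u v) = dotp u v.
Proof.
by move=> u1 v1; rewrite acosK// in_itv/=; exact: dotp_sphere2_itv.
Qed.

Lemma is_derive_dotp u v a b :
  is_derive (0 : R) 1 (fun t : R => dotp (u + t *: a) (v + t *: b))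
    (dotp u b + dotp a v).
Proof.
(* The scalar product is a polynomial in t of degree at most 2. *)
pose p : R -> R := cst (dotp u v) + (dotp u b + dotp a v) \*: id +
                   dotp a b \*: (id * id).
have -> : (fun t : R => dotp (u + t *: a) (v + t *: b)) = p.
  apply/funext => t; rewrite /p !fctE !(dotpDl, dotpDr, dotpZl, dotpZr).
  by rewrite /GRing.scale_fun /GRing.scale/=; ring.
apply: is_derive_eq.
by rewrite /GRing.scale/=; ring.
Qed.

(** The derivative of the squared norm is 2 <u, a>, which vanishes for tangent
a. *)
Lemma is_derive_enorm u a : sphere2 u -> tangent_space u a ->
  is_derive (0 : R) 1 (fun t : R => enorm (u + t *: a)) 0.
Proof.
move=> u1 ua.
have g := is_derive_dotp u u a a.
have g0 : dotp (u + 0 *: a) (u + 0 *: a) = 1.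
  by rewrite scale0r addr0 sphere2_dotp.
have s : is_derive (dotp (u + 0 *: a) (u + 0 *: a)) 1 Num.sqrt
    (2 * Num.sqrt (dotp (u + 0 *: a) (u + 0 *: a)))^-1.
  by apply: is_derive1_sqrt; rewrite g0.
have := is_derive1_comp s g.
by rewrite (dotpC a) [dotp u a]ua addr0 mulr0.
Qed.

(** The two normalizing factors have value 1 and derivative 0 at t = 0, so only
the scalar product of the unnormalized vectors contributes; the interval
condition keeps acos away from its singular endpoints. *)
Lemma is_derive_angle u v a b :
  sphere2 u -> sphere2 v -> tangent_space u a -> tangent_space v b ->
  -1 < dotp u v < 1 ->
  is_derive (0 : R) 1
    (fun t : R => angle (normalize (u + t *: a)) (normalize (v + t *: b)))
    (- (Num.sqrt (1 - dotp u v ^+ 2))^-1 * (dotp u b + dotp a v)).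
Proof.
move=> u1 v1 ua vb uv.
pose n (x c : 'rV[R]_3) (t : R) : R := (enorm (x + t *: c))^-1.
have n0 x c : sphere2 x -> n x c 0 = 1.
  by move=> x1; rewrite /n scale0r addr0 x1 invr1.
have dn x c : sphere2 x -> tangent_space x c -> is_derive (0 : R) 1 (n x c) 0.
  move=> x1 xc; have dx := is_derive_enorm x1 xc.
  pose e (t : R) := enorm (x + t *: c).
  have e0 : e 0 != 0 by rewrite /e scale0r addr0 x1 oner_neq0.
  by have := @is_deriveV _ e 0 _ _ e0 dx; rewrite scaler0.
pose d (t : R) : R := dotp (u + t *: a) (v + t *: b).
have d0 : d 0 = dotp u v by rewrite /d !scale0r !addr0.
have dd : is_derive (0 : R) 1 d _ := is_derive_dotp u v a b.
have dnu := dn _ _ u1 ua; have dnv := dn _ _ v1 vb.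
have dg : is_derive (0 : R) 1 (n u a * n v b * d) (dotp u b + dotp a v).
  apply: is_derive_eq; rewrite !fctE !n0// d0 /GRing.scale/=; ring.
have g0 : (n u a * n v b * d) 0 = dotp u v by rewrite !fctE !n0// d0 !mul1r.
have -> : (fun t : R => angle (normalize (u + t *: a)) (normalize (v + t *: b)))
    = acos \o (n u a * n v b * d).
  by apply/funext => t; rewrite /angle /normalize dotpZl dotpZr mulrA.
by apply: is_derive1_comp dg; rewrite g0; exact: is_derive1_acos.
Qed.

End dotp.

(** * Contact edges and balanced stresses *)

Section configuration.
Variables (R : realType) (N : nat) (U : 'I_N -> 'rV[R]_3).

Lemma inj_radius_le i j : i != j ->
  inj_radius U <= 2^-1 * angle (U i) (U j).
Proof.
move=> ij; rewrite /inj_radius ler_pM2l ?invr_gt0//.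
exact: (@bigmin_le_cond _ _ _ _ (i, j) (fun p => p.1 != p.2)
  (fun p => angle (U p.1) (U p.2))).
Qed.

Lemma contact_sym i j : contact U i j = contact U j i.
Proof. by rewrite /contact/= eq_sym /angle dotpC. Qed.

Hypothesis hU : Conf U.

Lemma Conf_sphere2 i : sphere2 (U i).
Proof. by case: hU. Qed.
Hint Resolve Conf_sphere2 : core.

Lemma contact_dotp i j : contact U i j ->
  dotp (U i) (U j) = cos (2 * inj_radius U).
Proof. by move=> /andP[_ /eqP <-]; rewrite cos_angle. Qed.

Lemma Conf_dotp_lt1 i j : i != j -> dotp (U i) (U j) < 1.
Proof.
move=> ij; have /andP[_ le1] := dotp_sphere2_itv (Conf_sphere2 i) (Conf_sphere2 j).
rewrite lt_neqAle le1 andbT; apply: contra_neq ij => ij1.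
by case: hU => _; apply; exact: dotp_sphere2_eq1.
Qed.

(** An antipodal contact pair would make the minimal angle equal to pi, so all
points would be pairwise antipodal; a third point would then coincide with one
of the first two. *)
Lemma contact_dotp_gtN1 i j : (3 <= N)%N -> contact U i j ->
  -1 < dotp (U i) (U j).
Proof.
move=> hN /andP[ij /eqP ijr].
have /andP[geN1 _] := dotp_sphere2_itv (Conf_sphere2 i) (Conf_sphere2 j).
rewrite lt_neqAle geN1 andbT; apply/negP => /eqP /esym ijN1.
have [k] : exists k, k \notin [set i; j]%SET.
  apply/existsP; rewrite -negb_forall; apply/negP => /forallP all2.
  have : (N <= 2)%N.
    rewrite -[N]card_ord -cardsT; apply: leq_trans (_ : #|[set i; j]%SET| <= 2)%N.
      by apply: subset_leq_card; apply/fintype.subsetP => k _; exact: all2.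
    by rewrite cards2; case: (_ != _).
  by rewrite leqNgt hN.
rewrite !inE negb_or => /andP[ki kj].
have ikpi : angle (U i) (U k) = pi.
  apply/le_anti; rewrite acos_lepi ?dotp_sphere2_itv//=.
  have := inj_radius_le ki.
  rewrite /angle dotpC -/(angle _ _).
  move: ijr; rewrite /angle ijN1 acosN1; lra.
have ikN1 : dotp (U i) (U k) = -1 by rewrite -cos_angle// ikpi cospi.
have : U k = U j.
  apply/oppr_inj; rewrite -(dotp_sphere2_eqN1 _ _ ikN1)//.
  exact: dotp_sphere2_eqN1.
by case: hU => _ /[apply] kjE; rewrite kjE eqxx in kj.
Qed.

(** The outward tangent at u_i towards u_j is (c u_i - u_j) / sqrt (1 - c^2)
with c the common cosine of the contact edges.  Pairing it with a tangent
vector v kills u_i, and the square root factors out of the balance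
equation. *)
Lemma balanced_stress_tangent w i v : (3 <= N)%N -> balanced_stress U w ->
  tangent_space (U i) v ->
  \sum_(j | contact U i j) w i j * dotp v (U j) = 0.
Proof.
move=> hN [_ /(_ i) bal] iv.
set c := cos (2 * inj_radius U).
have nE j : contact U i j ->
    enorm (dotp (U i) (U j) *: U i - U j) = Num.sqrt (1 - c ^+ 2).
  move=> ij; rewrite /enorm; congr Num.sqrt.
  rewrite !(dotpDl, dotpDr, dotpNl, dotpNr, dotpZl, dotpZr) (dotpC (U j) (U i)).
  rewrite !sphere2_dotp// (contact_dotp ij) -/c; ring.
have [[j0 ij0]|no] := pselect (exists j, contact U i j); last first.
  by rewrite big1// => j ij; exfalso; apply: no; exists j.
have s0 : Num.sqrt (1 - c ^+ 2) != 0.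
  have := contact_dotp_gtN1 hN ij0; rewrite (contact_dotp ij0) -/c => cN1.
  have : c < 1.
    by rewrite /c -(contact_dotp ij0); apply: Conf_dotp_lt1; case/andP: ij0.
  by move=> c1; rewrite gt_eqF// sqrtr_gt0; nra.
(* Multiplying by minus the square root clears the sign and the denominator. *)
move/(congr1 (fun x => - Num.sqrt (1 - c ^+ 2) * dotp x v)): bal.
rewrite dotp0l mulr0 dotp_suml mulr_sumr => bal.
rewrite -[RHS]bal; apply: eq_bigr => j ij.
rewrite /outward_tangent /normalize nE// !dotpZl dotpDl dotpNl dotpZl.
by rewrite [dotp (U i) v]iv (dotpC (U j)); field.
Qed.

End configuration.

Unset Implicit Arguments.

Theorem theorem4p11 (R : realType) (N : nat) (hN : (3 <= N)%N)
    (U : 'I_N -> 'rV[R]_3) (hU : Conf U) :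
  balanced U -> critical U.
Proof.
move=> [w [balw [i0 [j0 [c0 w0]]]]] V tV.
have [str _] := balw.
pose c := cos (2 * inj_radius U).
pose k : R := - (Num.sqrt (1 - c ^+ 2))^-1.
apply: (@weighted_min_littleo R ('I_N * 'I_N)%type
  (fun p => contact U p.1 p.2) (fun p => w p.1 p.2)
  (fun p t => 2^-1 * angle (deform U V t p.1) (deform U V t p.2))
  (fun p => 2^-1 * (k * (dotp (U p.1) (V p.2) + dotp (V p.1) (U p.2))))).
- by move=> [i j] /= ij; have [] := str i j ij.
- rewrite lt_neqAle sumr_ge0 ?andbT; last first.
    by move=> [i j] /= ij; have [] := str i j ij.
  rewrite eq_sym psumr_neq0; last by move=> [i j] /= ij; have [] := str i j ij.
  apply/hasP; exists (i0, j0); first by rewrite mem_index_enum.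
  by rewrite /= c0 lt_neqAle eq_sym w0; have [] := str _ _ c0.
- move=> [i j] /= ij; rewrite /deform !scale0r !addr0 /normalize.
  have [uU _] := hU; rewrite !uU invr1 !scale1r.
  by move: ij => /andP[_ /eqP->]; lra.
- by move=> [i j] t /= /andP[ij _]; exact: inj_radius_le.
- move=> [i j] /= ij; apply: is_deriveZ.
  rewrite /k /c -(contact_dotp hU ij).
  apply: is_derive_angle; rewrite ?contact_dotp_gtN1//=; try by [exact: tV | case: hU].
  by apply: Conf_dotp_lt1 => //; case/andP: ij.
- under eq_bigr do rewrite mulrCA (mulrCA _ k) mulrDr.
  rewrite -!mulr_sumr big_split/= [X in X + _](_ : _ = 0) ?add0r.
    rewrite -(pair_big_dep xpredT (contact U) (fun i j => w i j * dotp (V i) (U j)))/=.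
    rewrite big1 ?mulr0// => i _; exact: balanced_stress_tangent.
  rewrite -(pair_big_dep xpredT (contact U) (fun i j => w i j * dotp (U i) (V j)))/=.
  (* Exchanging the labels turns <u_i, v_j> into the terms of the balance
     equation at u_j. *)
  rewrite (exchange_big_dep xpredT)//= big1// => j _.
  rewrite -[RHS](balanced_stress_tangent hU hN balw (tV j)).
  apply: eq_big => [i|i ij]; first by rewrite contact_sym.
  by rewrite dotpC; have [->] := str i j ij.
Qed.
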